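(* Assume that $\nabla^2V$ is $\Gamma$-Lipschitz on $U^\nu$. Fix $\varepsilon\in(0,\nu)$, and assume that $V$ satisfies the {\L}ojasiewicz inequality $$|\nabla V(x)|\ge\mu V(x)^\theta,\qquad\forall x\in U^\varepsilon,$$ for some $\mu>0$ and $\theta\in\left[\frac12,1\right)$. Suppose moreover that there is a class-$\mathcal K$ function $M:[0,\nu]\to\mathbb R_{\ge0}$ with $$\sup_{x\in U^\nu,\ V(x)\le v}|\nabla V(x)|\le M(v)\quad\text{for all }v\in[0,\nu],$$ which can be chosen so that $M(\delta)\le C_M\delta^\theta$ for all $\delta\in[0,\nu]$, for some constant $C_M>0$ (with the same $\theta$). Then, for any $c>1$ and $H_{\min}>0$, there exist $T_{\mathrm{update}}>0$ and $h_0>0$ such that, for every $0<h<h_0$, the sequence $\{x_k\}$ generated from $x_0=x_I\in\Lambda$ by the Euler feedback integrator with time-periodic gain update (with parameters $h,c,H_{\min},T_{\mathrm{update}}$, as defined in the context) satisfies $$V(x_k)\le\varepsilon,\qquad\forall k\ge0.$$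
   Context: Setting. A smooth manifold (the state space) is embedded in $\mathbb R^n$, and $\dot x=f(x)$, with initial state $x_I$ in the state space, is a dynamical system on it whose solutions there exist globally and which admits first integrals $f_1,\dots,f_\ell$. The vector field $f$ and the functions $f_j$ are assumed to extend smoothly to an open neighborhood $U\subset\mathbb R^n$ of the state space (same symbols for the extensions, so $f:U\to\mathbb R^n$). $\Lambda$ is the set of $x$ in the state space with $f_j(x)=f_j(x_I)$, $j=1,\dots,\ell$. $V:U\to\mathbb R_{\ge 0}$ is an analytic function with $V^{-1}(0)=\Lambda$ such that: (A1) $\langle\nabla V(x),f(x)\rangle=0$ for all $x\in U$; (A2) $\nu>0$ is such that $V^{-1}([0,\nu])\subseteq U$ is compact; (A3) all critical points of $V$ in $V^{-1}([0,\nu])$ lie in $V^{-1}(0)$. For $\varepsilon>0$ write $U^\varepsilon:=V^{-1}([0,\varepsilon])$. $|\cdot|$ is the Euclidean norm and $\|\cdot\|$ the matrix 2-norm; ''$\nabla^2V$ is $\Gamma$-Lipschitz on $U^\nu$'' means $\|\nabla^2V(x)-\nabla^2V(y)\|\le\Gamma|x-y|$ for all $x,y\in U^\nu$. A class-$\mathcal K$ function is a continuous strictly increasing function vanishing at $0$. Euler feedback integrator with time-periodic gain update, with step size $h>0$, safety factor $c>1$, clip $H_{\min}>0$ and period $T_{\mathrm{update}}>0$: set $x_0=x_I$, $k=0$, $t_{\mathrm{next}}=0$. At each step $k=0,1,2,\dots$: if $kh\ge t_{\mathrm{next}}$, set $B\leftarrow\max\{\|\nabla^2V(x_k)\|,H_{\min}\}$,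 $\beta\leftarrow\frac{1}{cB}$ and $t_{\mathrm{next}}\leftarrow t_{\mathrm{next}}+T_{\mathrm{update}}$; otherwise keep the current $\beta$. Then set $x_{k+1}=x_k+hf(x_k)-\beta\nabla V(x_k)$. The conclusion includes that all iterates are defined, i.e. remain in $U$. *)

(* Defs.v *)
From HB Require Import structures.
From mathcomp Require Import all_boot all_order all_algebra.
From mathcomp Require Import finmap.
From mathcomp Require Import all_classical all_reals all_analysis.
Set Implicit Arguments.
Unset Strict Implicit.
Unset Printing Implicit Defensive.
Import Order.TTheory GRing.Theory Num.Theory.
Import numFieldNormedType.Exports.
Local Open Scope classical_set_scope.
Local Open Scope ring_scope.

(** Points of R^n are row vectors.  The library norm on ['rV[R]_n] is the sup
    norm; it induces the usual topology and differential calculus, but metric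
    hypotheses use the Euclidean norm [enorm].  Functions defined on an open
    set U are represented by total functions that are only constrained on U. *)

Section Euclidean.
Context {R : realType}.

Definition dotv n (u v : 'rV[R]_n) : R := \sum_i u 0 i * v 0 i.

Definition enorm n (u : 'rV[R]_n) : R := Num.sqrt (dotv u u).

(** [v *m A^T] is the row form of the column product [A v]. *)
Definition mnorm2 n (A : 'M[R]_n) : R :=
  sup [set enorm (v *m A^T) | v in [set v : 'rV[R]_n | enorm v <= 1]].

End Euclidean.

Section Calculus.
Context {R : realType} {n : nat}.

Definition partial {W : normedModType R} (i : 'I_n) (g : 'rV[R]_n -> W) :
  'rV[R]_n -> W := 'D_(delta_mx 0 i) g.

Fixpoint Ck {W : normedModType R} (k : nat) (U : set 'rV[R]_n)
    (g : 'rV[R]_n -> W) : Prop :=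
  (forall x, U x -> {for x, continuous g}) /\
  (if k is k'.+1 then
     forall i : 'I_n,
       (forall x, U x -> derivable g x (delta_mx 0 i)) /\ Ck k' U (partial i g)
   else True).

Definition smooth_on {W : normedModType R} (U : set 'rV[R]_n)
  (g : 'rV[R]_n -> W) : Prop := forall k, Ck k U g.

Definition mpartial (a : {ffun 'I_n -> nat}) (g : 'rV[R]_n -> R) :
    'rV[R]_n -> R :=
  foldr (fun i u => iter (a i) (partial i) u) g (enum 'I_n).

Definition has_sum {I : choiceType} (a : I -> R) (s : R) : Prop :=
  forall e : R, 0 < e -> exists A0 : {fset I}, forall A : {fset I},
    (A0 `<=` A)%fset -> `|s - \sum_(i <- A) a i| < e.

Definition taylor_term (g : 'rV[R]_n -> R) (p x : 'rV[R]_n)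
    (a : {ffun 'I_n -> nat}) : R :=
  mpartial a g p / (\prod_i (a i)`!)%:R * \prod_i (x 0 i - p 0 i) ^+ a i.

(** Real analyticity: smooth, and near each point of U equal to the sum of its
    Taylor series (unordered, hence absolutely convergent, over multi-indices). *)
Definition analytic_on (U : set 'rV[R]_n) (g : 'rV[R]_n -> R) : Prop :=
  smooth_on U g /\
  forall p, U p -> \forall x \near p, has_sum (taylor_term g p x) (g x).

Definition grad (V : 'rV[R]_n -> R) (x : 'rV[R]_n) : 'rV[R]_n :=
  \row_i partial i V x.

Definition hessian (V : 'rV[R]_n -> R) (x : 'rV[R]_n) : 'M[R]_n :=
  \matrix_(i, j) partial i (partial j V) x.

End Calculus.

Section Dynamics.
Context {R : realType} {n : nat}.

(** Smooth d-dimensional embedded submanifold of R^n, by local slice charts: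
    phi is a diffeomorphism from an open W onto the open set [phi @` W], with
    inverse psi, mapping S into R^d x {0}. *)
Definition embedded_submanifold (d : nat) (S : set 'rV[R]_n) : Prop :=
  (d <= n)%N /\
  forall p, S p -> exists W (phi psi : 'rV[R]_n -> 'rV[R]_n),
    [/\ open W /\ W p,
        open (phi @` W),
        smooth_on W phi /\ smooth_on (phi @` W) psi,
        forall x, W x -> psi (phi x) = x &
        forall x, W x ->
          (S x <-> forall i : 'I_n, (d <= i)%N -> phi x 0 i = 0)].

Definition tangent_vector (S : set 'rV[R]_n) (x v : 'rV[R]_n) : Prop :=
  exists gamma : R -> 'rV[R]_n,
    [/\ gamma 0 = x, \forall t \near (0 : R), S (gamma t) &
        is_derive (0 : R) 1 gamma v].

Definition solution_in (S : set 'rV[R]_n) (f : 'rV[R]_n -> 'rV[R]_n)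
    (gamma : R -> 'rV[R]_n) : Prop :=
  [/\ {within `[0, +oo[, continuous gamma},
      forall t : R, 0 <= t -> S (gamma t) &
      forall t : R, 0 < t -> is_derive t 1 gamma (f (gamma t))].

(** A dynamical system on S: tangent to S, with a solution in S defined for all
    t >= 0 from every initial state in S. *)
Definition global_dynamics (S : set 'rV[R]_n) (f : 'rV[R]_n -> 'rV[R]_n) :=
  (forall x, S x -> tangent_vector S x (f x)) /\
  (forall x, S x -> exists2 gamma, gamma 0 = x & solution_in S f gamma).

Definition first_integral (S : set 'rV[R]_n) (f : 'rV[R]_n -> 'rV[R]_n)
    (g : 'rV[R]_n -> R) : Prop :=
  forall gamma, solution_in S f gamma ->
    forall t : R, 0 <= t -> g (gamma t) = g (gamma 0).

Definition integral_level (l : nat) (S : set 'rV[R]_n)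
    (F : 'I_l -> 'rV[R]_n -> R) (xI : 'rV[R]_n) : set 'rV[R]_n :=
  [set x | S x /\ forall j, F j x = F j xI].

Definition sublevel (U : set 'rV[R]_n) (V : 'rV[R]_n -> R) (e : R) :
  set 'rV[R]_n := U `&` V @^-1` `[0, e].

Definition class_K (nu : R) (M : R -> R) : Prop :=
  [/\ {within `[0, nu], continuous M},
      {in `[0, nu] &, {homo M : s t / s < t}} & M 0 = 0].

End Dynamics.

Section Integrator.
Context {R : realType} {n : nat}.
Variables (f : 'rV[R]_n -> 'rV[R]_n) (V : 'rV[R]_n -> R).
Variables (h c Hmin Tupdate : R) (xI : 'rV[R]_n).

Record state := State { pos : 'rV[R]_n; gain : R; tnext : R }.

Definition update_gain (k : nat) (s : state) : state :=
  if tnext s <= k%:R * h then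
    State (pos s) (c * Num.max (mnorm2 (hessian V (pos s))) Hmin)^-1
      (tnext s + Tupdate)
  else s.

Definition advance (s : state) : state :=
  State (pos s + h *: f (pos s) - gain s *: grad V (pos s)) (gain s) (tnext s).

(** The initial gain 0 is a dummy: the test succeeds at k = 0. *)
Fixpoint integrator_state (k : nat) : state :=
  if k is k'.+1 then advance (update_gain k' (integrator_state k'))
  else State xI 0 0.

Definition integrator (k : nat) : 'rV[R]_n := pos (integrator_state k).

End Integrator.

(* Main.v *)
Require Import Defs.
From mathcomp Require Import all_boot all_order all_algebra.
From mathcomp Require Import ring lra.
From mathcomp Require Import all_classical all_reals all_analysis.
Import Order.TTheory GRing.Theory Num.Theory.
Import numFieldNormedType.Exports.
Local Open Scope classical_set_scope.
Local Open Scope ring_scope.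

(** The invariant is [V x_k <= kap * h ^ (1 / theta)].  On that sublevel set the
    growth bound on [M] gives [|grad V| <= CM * kap ^ theta * h], so one step is
    at most [h * D] long with [D] independent of [h], and the drift since the
    last gain update is at most [(Tupdate + h) * D].  For small [Tupdate] the
    Hessian therefore moves by at most [(c - 1) * Hmin], i.e. its norm stays
    below [1 / beta] along the whole step.  Since [grad V] is orthogonal to [f],
    Taylor's formula and the Lojasiewicz inequality then give
    [V x_(k+1) <= V x_k - a * (V x_k ^ theta) ^ 2 + b * h ^ 2], which preserves
    the invariant because [h ^ 2 <= h ^ (1 / theta)] when [theta >= 1 / 2]. *)

(** * Euclidean norm and matrix 2-norm *)

Section Euclid.
Context {R : realType} {n : nat}.
Implicit Types (u v w : 'rV[R]_n) (A B : 'M[R]_n) (a : R).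

Lemma dotvC u v : dotv u v = dotv v u.
Proof. by apply: eq_bigr => i _; rewrite mulrC. Qed.

Lemma dotvDl u v w : dotv (u + v) w = dotv u w + dotv v w.
Proof. by rewrite -big_split; apply: eq_bigr => i _; rewrite !mxE mulrDl. Qed.

Lemma dotvZl a u v : dotv (a *: u) v = a * dotv u v.
Proof.
by rewrite /dotv mulr_sumr; apply: eq_bigr => i _; rewrite !mxE mulrA.
Qed.

Lemma dotvDr u v w : dotv u (v + w) = dotv u v + dotv u w.
Proof. by rewrite dotvC dotvDl !(dotvC u). Qed.

Lemma dotvZr a u v : dotv u (a *: v) = a * dotv u v.
Proof. by rewrite dotvC dotvZl dotvC. Qed.

Lemma dotv_ge0 u : 0 <= dotv u u.
Proof. by apply: sumr_ge0 => i _; rewrite -expr2 sqr_ge0. Qed.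

Lemma enorm_ge0 u : 0 <= enorm u.
Proof. exact: sqrtr_ge0. Qed.

Lemma sqr_enorm u : enorm u ^+ 2 = dotv u u.
Proof. by rewrite sqr_sqrtr ?dotv_ge0. Qed.

Lemma dotv_eq0 u : dotv u u = 0 -> u = 0.
Proof.
move=> /eqP; rewrite psumr_eq0 => [/allP u0|i _];
  last by rewrite -expr2 sqr_ge0.
apply/rowP => i; rewrite mxE; have /= := u0 i (mem_index_enum _).
by rewrite mulf_eq0 orbb => /eqP.
Qed.

Lemma enorm0 : enorm (0 : 'rV[R]_n) = 0.
Proof. by rewrite /enorm /dotv big1 ?sqrtr0// => i _; rewrite mxE mul0r. Qed.

Lemma enormZ a u : enorm (a *: u) = `|a| * enorm u.
Proof.
by rewrite /enorm dotvZl dotvZr mulrA -expr2 sqrtrM ?sqr_ge0// sqrtr_sqr.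
Qed.

(** Cauchy-Schwarz: for [v] nonzero, expand the squared length of [dotv v v *: u - dotv u v *: v]
    and divide by [dotv v v]. *)
Lemma dotv_le u v : dotv u v <= enorm u * enorm v.
Proof.
have [->|v0] := eqVneq v 0.
  rewrite enorm0 mulr0 dotvC (_ : 0 = 0 *: u) ?scale0r// -{1}(scale0r u).
  by rewrite dotvZl mul0r.
have v2 : 0 < dotv v v.
  by rewrite lt_neqAle dotv_ge0 andbT eq_sym; apply: contra_neq v0 => /dotv_eq0.
apply: le_trans (ler_norm _) _.
rewrite -(ler_pXn2r (n := 2)) ?nnegrE ?mulr_ge0 ?enorm_ge0//.
rewrite exprMn !sqr_enorm real_normK ?num_real//.
have := dotv_ge0 (dotv v v *: u + (- dotv u v) *: v).
rewrite !(dotvDl, dotvDr, dotvZl, dotvZr) (dotvC v u) => h.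
rewrite -subr_ge0 -(pmulr_rge0 _ v2); apply: le_trans h _.
by rewrite le_eqVlt; apply/orP; left; apply/eqP; ring.
Qed.

Lemma enormD u v : enorm (u + v) <= enorm u + enorm v.
Proof.
rewrite -(ler_pXn2r (n := 2)) ?nnegrE ?addr_ge0 ?enorm_ge0//.
rewrite sqrrD !sqr_enorm dotvDl !dotvDr (dotvC v u).
have := dotv_le u v; lra.
Qed.

(** With [enorm_le_sup], this moves bounds between the sup norm behind the topology and the
    Euclidean norm of the hypotheses. *)
Lemma enorm_sup u : `|u| <= enorm u.
Proof.
rewrite [`|_|]mx_normrE; apply: bigmax_le => [|[i j] _] /=.
  exact: enorm_ge0.
rewrite -sqrtr_sqr ler_sqrt ?dotv_ge0// /dotv (bigD1 j)//= ord1 -expr2 lerDl.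
by apply: sumr_ge0 => k _; rewrite -expr2 sqr_ge0.
Qed.

Lemma coord_le_norm u i : `|u 0 i| <= `|u|.
Proof.
rewrite [leRHS]mx_normrE.
by rewrite (le_bigmax _ (fun ij : 'I_1 * 'I_n => `|u ij.1 ij.2|) (0, i)).
Qed.

Lemma enorm_le_sup u : enorm u <= n%:R * `|u|.
Proof.
have h : dotv u u <= (n%:R * `|u|) ^+ 2.
  apply: (@le_trans _ _ (n%:R * `|u| ^+ 2)).
    rewrite mulr_natl -[X in _ *+ X]card_ord -sumr_const; apply: ler_sum => i _.
    by rewrite -expr2 -real_normK ?num_real// lerXn2r ?nnegrE ?coord_le_norm.
  rewrite exprMn ler_wpM2r ?sqr_ge0// -natrX ler_nat.
  by case: (n) => // m; rewrite leq_pmull.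
rewrite -(ler_pXn2r (n := 2)) ?nnegrE ?mulr_ge0 ?enorm_ge0//.
by rewrite sqr_enorm.
Qed.

Let image_ball A := [set enorm (v *m A^T) | v in [set v | enorm v <= 1]].

(** Makes the [sup] in [mnorm2] a genuine least upper bound: the sum of the absolute values of the
    entries bounds the image of the unit ball in sup norm. *)
Lemma mnorm2_has_sup A : has_sup (image_ball A).
Proof.
split.
  by exists (enorm (0 *m A^T)); exists 0 => //=; rewrite enorm0 ler01.
have cont : exists C, forall v, `|v| <= 1 -> `|v *m A^T| <= C.
  exists (\sum_i \sum_j `|A i j|) => v v1.
  have s0 : 0 <= \sum_i \sum_j `|A i j|.
    by apply: sumr_ge0 => i _; apply: sumr_ge0.
  rewrite [`|_|]mx_normrE; apply: bigmax_le => [|[k i] _] //=; rewrite mxE.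
  rewrite [leRHS](bigD1 i)//=; apply: ler_wpDr.
    by apply: sumr_ge0 => ? _; apply: sumr_ge0.
  apply: le_trans (ler_norm_sum _ _ _) _; apply: ler_sum => j _.
  rewrite mxE normrM ler_piMl// ord1.
  exact: le_trans (coord_le_norm _ _) v1.
case: cont => C hC; exists (n%:R * C) => _ [v /= v1 <-].
apply: le_trans (enorm_le_sup _) _; rewrite ler_wpM2l// hC//.
exact: le_trans (enorm_sup _) v1.
Qed.

Lemma mnorm2_ge0 A : 0 <= mnorm2 A.
Proof.
apply: le_trans (enorm_ge0 (0 *m A^T)) _; apply: ub_le_sup.
  by case: (mnorm2_has_sup A).
by exists 0 => //=; rewrite enorm0 ler01.
Qed.

Lemma enorm_mulmx A v : enorm (v *m A^T) <= mnorm2 A * enorm v.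
Proof.
have [->|v0] := eqVneq v 0.
  by rewrite mul0mx enorm0 mulr0.
have v1 : 0 < enorm v.
  rewrite lt_neqAle enorm_ge0 andbT eq_sym; apply: contra_neq v0 => ve.
  by apply: dotv_eq0; rewrite -sqr_enorm ve expr2 mul0r.
rewrite -ler_pdivrMr// mulrC.
have <- : enorm ((enorm v)^-1 *: v *m A^T) = (enorm v)^-1 * enorm (v *m A^T).
  by rewrite -scalemxAl enormZ ger0_norm ?invr_ge0 ?enorm_ge0.
apply: ub_le_sup; first by case: (mnorm2_has_sup A).
exists ((enorm v)^-1 *: v) => //=.
by rewrite enormZ ger0_norm ?invr_ge0 ?enorm_ge0// mulVf ?gt_eqF.
Qed.

Lemma mnorm2D A B : mnorm2 (A + B) <= mnorm2 A + mnorm2 B.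
Proof.
apply: ge_sup; first by case: (mnorm2_has_sup (A + B)).
move=> _ [v /= v1 <-]; rewrite linearD /= mulmxDr.
apply: le_trans (enormD _ _) _.
by apply: lerD; apply: le_trans (enorm_mulmx _ _) _;
  rewrite ler_piMr ?mnorm2_ge0.
Qed.

Lemma quadratic_form_le A v : dotv v (v *m A^T) <= mnorm2 A * dotv v v.
Proof.
apply: le_trans (dotv_le _ _) _.
rewrite -sqr_enorm expr2 [leRHS]mulrCA.
by rewrite ler_wpM2l ?enorm_ge0// enorm_mulmx.
Qed.

End Euclid.

(** * Directional derivatives and second-order Taylor bound *)

Section Directional.
Context {R : realType} {n : nat}.
Implicit Types (g V : 'rV[R]_n -> R) (U : set 'rV[R]_n) (x v : 'rV[R]_n).

Lemma is_derive_line g x v (t df : R) :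
  is_derive (x + t *: v) v g df ->
  is_derive t 1 (fun s : R => g (x + s *: v)) df.
Proof.
have eqq : (fun h : R => h^-1 *: (g (h *: v + (x + t *: v)) - g (x + t *: v))) =
  (fun h : R => h^-1 *: (g (x + (h *: 1 + t) *: v) - g (x + t *: v))).
  apply/funext => h; congr (_ *: (g _ - _)).
  by rewrite [_ *: 1]mulr1 scalerDl addrCA.
move=> [dg <-]; split; first by move: dg; rewrite /derivable /= eqq.
by rewrite /derive /= eqq.
Qed.

(** Parametrizing the segment by [s] in [0, 1] handles increments [a] of either sign at once. *)
Lemma MVT_line g x v (a : R) :
  (forall s : R, 0 <= s <= 1 -> derivable g (x + (s * a) *: v) v) ->
  exists2 s : R, 0 <= s <= 1 &
    g (x + a *: v) - g x = a * 'D_v g (x + (s * a) *: v).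
Proof.
move=> dg; pose phi (s : R) := g (x + (s * a) *: v).
have dphi (s : R) : 0 <= s <= 1 ->
    is_derive s 1 phi ('D_v g (x + (s * a) *: v) * a).
  move=> /dg/derivableP/is_derive_line ds.
  have da : is_derive s (1 : R) (fun s : R => s * a) a.
    by apply: is_derive_eq; rewrite scaler0 add0r [_ *: 1]mulr1.
  exact: (@is_derive1_comp _
    (fun t : R => g (x + t *: v)) (fun s : R => s * a)).
have [||s] := @MVT_segment _ phi
  (fun s => 'D_v g (x + (s * a) *: v) * a) 0 1 ler01.
- by move=> s; rewrite in_itv/= => /andP[? ?]; apply: dphi; rewrite !ltW.
- apply: derivable_within_continuous => s; rewrite in_itv/= => s01.
  by have [] := dphi s s01.
rewrite in_itv/= => s01; rewrite /phi mul1r mul0r scale0r addr0 subr0 mulr1.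
move=> ->.
by exists s => //; rewrite mulrC.
Qed.

(** The vertices [x + trunc v k] form a path from [x] to [x + v] whose edges are parallel to the
    axes. *)
Let trunc v k : 'rV[R]_n := \row_i (if (i < k)%N then v 0 i else 0).

Let truncS v (i : 'I_n) : trunc v i.+1 = trunc v i + v 0 i *: delta_mx 0 i.
Proof.
apply/rowP => j; rewrite !mxE eqxx ltnS leq_eqVlt (inj_eq val_inj) /=.
have [->|ji] := eqVneq j i; first by rewrite ltnn mulr1 add0r.
by rewrite mulr0 addr0.
Qed.

(* Telescope along the coordinates and apply the mean value theorem to each. *)
Lemma C1_estimate {U g x} {e : R} : open U -> Ck 1 U g -> U x -> 0 < e ->
  \forall v \near (0 : 'rV[R]_n),
    `|g (x + v) - g x - \sum_i v 0 i * partial i g x| <= e * `|v|.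
Proof.
move=> Uo [_ C1] Ux e0.
(* The [n] edges contribute at most [e'] times [|v|] each; [n.+1] keeps the divisor positive when
   [n] is 0. *)
pose e' := e / n.+1%:R.
have e'0 : 0 < e' by rewrite divr_gt0.
have : \forall y \near x,
    U y /\ forall i, `|partial i g x - partial i g y| <= e'.
  have Ci i : \forall y \near x, `|partial i g x - partial i g y| <= e'.
    by have [_ [+ _]] := C1 i => /(_ x Ux)/cvgrPdist_le/(_ _ e'0).
  have CA := filter_forall _ Ci.
  by apply: filterI; [exact: open_nbhs_nbhs|exact: CA].
move=> /nbhs_normP[r /= r0 xr].
have near_r := @nbhs0_lt _ 'rV[R]_n _ r0.
near=> v.
have vr : `|v| < r.
  by near: v; exact: near_r.
(* Every point of an edge differs from [x] by a vector whose coordinates are dominated by those of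
   [v], hence stays in the sup-norm ball of radius [r]. *)
have box (i : 'I_n) (s : R) : 0 <= s <= 1 ->
    let y := x + (trunc v i + (s * v 0 i) *: delta_mx 0 i) in
    U y /\ forall j, `|partial j g x - partial j g y| <= e'.
  move=> /andP[s0 s1] y; apply: xr => /=; rewrite opprD addNKr normrN.
  apply: le_lt_trans vr; rewrite [leLHS]mx_normrE; apply: bigmax_le => //
    -[k j] _ /=.
  rewrite ord1 !mxE eqxx /= ; apply: le_trans (coord_le_norm v j).
  have [->|ji] := eqVneq j i.
    by rewrite ltnn add0r mulr1 normrM ger0_norm// ler_piMl.
  by rewrite mulr0 addr0; case: ifP => // _; rewrite normr0.
have tel : g (x + v) - g x =
    \sum_(i < n) (g (x + trunc v i.+1) - g (x + trunc v i)).
  rewrite -(big_mkord xpredT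
    (fun i => g (x + trunc v i.+1) - g (x + trunc v i))).
  have t0 : trunc v 0 = 0 by apply/rowP => j; rewrite !mxE.
  have tn : trunc v n = v by apply/rowP => j; rewrite mxE ltn_ord.
  by rewrite (telescope_sumr (fun i => g (x + trunc v i)))// t0 tn addr0.
rewrite tel -sumrB; apply: le_trans (ler_norm_sum _ _ _) _.
apply: (@le_trans _ _ (\sum_(i < n) e' * `|v|)); last first.
  rewrite sumr_const card_ord -mulr_natl mulrA ler_wpM2r//
    /e' mulrCA ler_piMr ?(ltW e0)//.
  by rewrite ler_pdivrMr// mul1r ler_nat.
apply: ler_sum => i _.
have [s s01 ->] : exists2 s : R, 0 <= s <= 1 &
    g (x + trunc v i.+1) - g (x + trunc v i) =
    v 0 i * partial i g (x + (trunc v i + (s * v 0 i) *: delta_mx 0 i)).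
  have [s s01|s s01] := @MVT_line g (x + trunc v i) (delta_mx 0 i) (v 0 i).
    by rewrite -addrA; have [dg _] := C1 i; apply: dg; case: (box i s s01).
  by rewrite -!addrA -truncS => ->; exists s.
rewrite -mulrBr normrM mulrC ler_pM//; last exact: coord_le_norm.
by rewrite distrC; case: (box i s s01).
Unshelve. all: by end_near. Qed.

(** [Ck] only supplies partial derivatives; dividing [C1_estimate] for [h *: v] by [h] yields the
    derivative along any direction. *)
Lemma C1_is_derive {U g x} v : open U -> Ck 1 U g -> U x ->
  is_derive x v g (\sum_i v 0 i * partial i g x).
Proof.
move=> Uo C1 Ux; set df := \sum_i _.
have : (fun h : R => h^-1 *: (g (h *: v + x) - g x)) @ 0^' --> df.
  apply/cvgrPdist_le => e e0.
  have e'0 : 0 < e / (`|v| + 1) by rewrite divr_gt0 ?ltr_wpDl.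
  have := C1_estimate Uo C1 Ux e'0 => /nbhs_normP[r /= r0 hr].
  near=> h.
  have h0 : h != 0 by near: h; exact: nbhs_dnbhs_neq.
  have /hr : ball_ Num.norm 0 r (h *: v).
    rewrite /= sub0r normrN normrZ.
    have hs : `|h| < r / (`|v| + 1).
      by near: h; apply: dnbhs0_lt; rewrite divr_gt0 ?ltr_wpDl.
    rewrite ltr_pdivlMr ?ltr_wpDl// in hs.
    by apply: le_lt_trans hs; rewrite ler_wpM2l// lerDl.
  rewrite /= (addrC x) => le1.
  rewrite distrC.
  have -> : h^-1 *: (g (h *: v + x) - g x) - df =
      h^-1 * (g (h *: v + x) - g x - \sum_i (h *: v) 0 i * partial i g x).
    rewrite mulrBr; congr (_ - _); rewrite mulr_sumr; apply: eq_bigr => i _.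
    by rewrite mxE !mulrA mulVf// mul1r.
  rewrite normrM normfV ler_pdivrMl ?normr_gt0//.
  apply: le_trans le1 _; rewrite normrZ mulrCA ler_wpM2l//
    -mulrA ler_piMr ?(ltW e0)//.
  by rewrite mulrC ler_pdivrMr ?ltr_wpDl// mul1r lerDl.
move=> cv; split; last exact: cvg_lim.
by apply/cvg_ex; exists df.
Unshelve. all: by end_near. Qed.

Lemma dotv_grad V x v : dotv (grad V x) v = \sum_i v 0 i * partial i V x.
Proof. by apply: eq_bigr => i _; rewrite mxE mulrC. Qed.

(** The mean value theorem is applied twice along the segment: first to bound the slope [dphi t] by
    an affine function of [t], then to compare [phi] with the resulting parabola. *)
Lemma taylor2_le {U V x v} (B : R) : open U -> Ck 1 U V ->
    (forall i, Ck 1 U (partial i V)) ->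
    (forall t : R, 0 <= t <= 1 ->
       U (x + t *: v) /\ mnorm2 (hessian V (x + t *: v)) <= B) ->
  V (x + v) <= V x + dotv (grad V x) v + B / 2 * dotv v v.
Proof.
move=> Uo C1 C2 seg.
pose phi (t : R) := V (x + t *: v).
pose dphi (t : R) := dotv (grad V (x + t *: v)) v.
have d1 (t : R) : 0 <= t <= 1 -> is_derive t 1 phi (dphi t).
  move=> /seg[Ut _]; rewrite /dphi dotv_grad.
  by apply: is_derive_line; apply: (C1_is_derive v Uo C1 Ut).
pose ddphi (t : R) := dotv v (v *m (hessian V (x + t *: v))^T).
have d2 (t : R) : 0 <= t <= 1 -> is_derive t 1 dphi (ddphi t).
  move=> /seg[Ut _].
  have -> : dphi = \sum_i (fun t => v 0 i * partial i V (x + t *: v)).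
    by apply/funext => s; rewrite /dphi dotv_grad fct_sumE.
  have -> : ddphi t =
      \sum_i v 0 i * \sum_j v 0 j * partial j (partial i V) (x + t *: v).
    rewrite /ddphi /dotv.
    under eq_bigr do rewrite mxE mulr_sumr.
    under [RHS]eq_bigr do rewrite mulr_sumr.
    (* Swapping the sums aligns the order of differentiation on both sides. *)
    rewrite exchange_big; apply: eq_bigr => i _; apply: eq_bigr => j _.
    by rewrite !mxE; ring.
  apply: is_derive_sum => i.
  apply: is_deriveZ; apply: is_derive_line.
  by apply: (C1_is_derive v Uo (C2 i) Ut).
have dd_le (t : R) : 0 <= t <= 1 -> ddphi t <= B * dotv v v.
  move=> /seg[_ Bt]; apply: le_trans (quadratic_form_le _ _) _.
  by rewrite ler_wpM2r ?dotv_ge0.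
have d_le (t : R) : 0 <= t <= 1 -> dphi t <= dphi 0 + t * (B * dotv v v).
  move=> /andP[t0 t1].
  have [||s] := @MVT_segment _ dphi ddphi 0 t t0.
  - move=> s; rewrite in_itv/= => /andP[s0 st]; apply: d2; rewrite ltW//=.
    exact: le_trans (ltW st) t1.
  - apply: derivable_within_continuous => s; rewrite in_itv/= => /andP[s0 st].
    by have [] := d2 s _; rewrite // s0 (le_trans st).
  rewrite in_itv/= subr0 => /andP[s0 st] e.
  rewrite -lerBlDl e mulrC ler_wpM2l// dd_le// s0; exact: le_trans st t1.
(* By [d_le] the derivative of [psi] is nonpositive on [0, 1], so [psi 1 <= psi 0], which is the
   claim. *)
pose psi := (fun t : R => phi t - t * dphi 0 - t ^+ 2 * (B / 2 * dotv v v)).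
have dpsi (t : R) : 0 <= t <= 1 ->
    is_derive t 1 psi (dphi t - dphi 0 - t * (B * dotv v v)).
  move=> /d1 h1; apply: is_derive_eq.
  rewrite !scaler0 !add0r ![_ *: _]mulr1 /=; rewrite /GRing.scale/=.
  by field.
have [||s] := @MVT_segment _ psi (fun t =>
  dphi t - dphi 0 - t * (B * dotv v v)) 0 1 ler01.
- by move=> s; rewrite in_itv/= => /andP[? ?]; apply: dpsi; rewrite !ltW.
- apply: derivable_within_continuous => s; rewrite in_itv/= => s01.
  by have [] := dpsi s s01.
rewrite in_itv/= subr0 => s01.
have := d_le s s01.
rewrite /psi /phi /dphi scale0r scale1r addr0 => h1 h2; lra.
Qed.

End Directional.

(** * Uniform constants from compactness of the sublevel set *)

Section Compactness.
Context {R : realType} {n : nat}.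
Implicit Types (V : 'rV[R]_n -> R) (K U : set 'rV[R]_n).

(** Local radii exist around each point of the compact [nu]-sublevel: where [V x <= eps], nearby
    points stay in [U] with [V < nu]; where [V x > eps], nearby points satisfy [P] vacuously.
    Compactness makes the radius uniform. *)
Lemma sublevel_thickening {U V} {eps nu : R} : open U ->
    (forall x, U x -> {for x, continuous V}) -> (forall x, U x -> 0 <= V x) ->
    compact (sublevel U V nu) -> eps < nu ->
  exists2 r : R, 0 < r & forall x y,
    sublevel U V eps x -> enorm (y - x) <= r -> sublevel U V nu y.
Proof.
move=> Uo cV V0 /compact_near_coveringP cK en.
pose P (r : R) x := sublevel U V eps x ->
  forall y, `|y - x| < r -> sublevel U V nu y.
have hP : \forall r \near (0^'+ : set_system R), sublevel U V nu `<=` P r.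
  apply: cK => x [Ux]; rewrite /= in_itv/= => /andP[_ Vx].
  have nU : \forall y \near x, U y by exact: open_nbhs_nbhs.
  have cVx : V @ x --> V x := cV x Ux.
  have [le|lt] := leP (V x) eps.
    have nV : \forall y \near x, V y < nu.
      by apply: cvgr_lt cVx _ (le_lt_trans le en).
    have : \forall y \near x, U y /\ V y < nu by exact: filterI.
    move=> /nbhs_normP[r /= r0 hr].
    exists (ball x (r / 2), [set s : R | s <= r / 2]) => /=.
      split; first by apply: nbhsx_ballx; rewrite divr_gt0.
      by apply: nbhs_right_le; rewrite divr_gt0.
    move=> [x' s] /=; rewrite -ball_normE /= => -[x'r sr] _ y yx'.
    have /hr[Uy Vy] : ball_ Num.norm x r y.
      rewrite /= -(subrK x' x) -addrA (splitr r).
      apply: le_lt_trans (ler_normD _ _) _; apply: ltrD => //.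
      by rewrite distrC; exact: lt_le_trans yx' sr.
    by split => //=; rewrite in_itv/= V0//= ltW.
  have nV : \forall y \near x, eps < V y.
    by apply: cvgr_gt cVx _ lt.
  exists ([set y | eps < V y], setT) => /=.
    by split => //; exact: filterT.
  move=> [x' s] /= [+ _] [_]; rewrite /= in_itv/= => h /andP[_].
  by rewrite leNgt h.
have : \forall r \near (0^'+ : set_system R), 0 < r /\ sublevel U V nu `<=` P r.
  by apply: filterI hP; exact: nbhs_right_gt.
move=> /filter_ex[r [r0 hr]].
exists (r / 2) => [|x y xe yx]; first by rewrite divr_gt0.
apply: (hr x) => //; last first.
  apply: le_lt_trans (enorm_sup _) _; apply: le_lt_trans yx _.
  by rewrite ltr_pdivrMr// ltr_pMr// ltr1n.
case: xe => Ux; rewrite /= !in_itv/= => /andP[V0x Vx].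
by split => //=; rewrite in_itv/= V0x (le_trans Vx)// ltW.
Qed.

Lemma compact_enorm_bounded {K} {f : 'rV[R]_n -> 'rV[R]_n} : compact K ->
    (forall x, K x -> {for x, continuous f}) ->
  exists2 C : R, 0 < C & forall x, K x -> enorm (f x) <= C.
Proof.
move=> /compact_near_coveringP cK cf.
have : \forall C \near (+oo : set_system R), K `<=` [set x | `|f x| <= C].
  apply: cK => x Kx.
  have fx : \forall y \near x, `|f y| <= `|f x| + 1.
    have := cf x Kx => /cvgrPdist_le/(_ _ ltr01); apply: filterS => y fy.
    by rewrite -(subrK (f x) (f y)) addrC (le_trans (ler_normD _ _))//
      lerD2l distrC.
  exists ([set y | `|f y| <= `|f x| + 1], [set C : R | `|f x| + 1 <= C]) => /=.
    by split => //; apply: nbhs_pinfty_ge; exact: num_real.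
  by move=> [y C] /= []; exact: le_trans.
move=> /filter_ex[C hC].
exists (n%:R * `|C| + 1) => [|x Kx]; first by rewrite ltr_wpDl ?mulr_ge0.
apply: le_trans (enorm_le_sup _) _; apply: ler_wpDr => //.
by rewrite ler_wpM2l// (le_trans (hC x Kx))// ler_norm.
Qed.

(** Comparison with the base point [x0] over the bounded set [K]; the absolute value of [G] covers a
    constant of unknown sign. *)
Lemma lipschitz_mnorm2_bounded {K} {H : 'rV[R]_n -> 'M[R]_n} {G : R} {x0} :
    compact K -> K x0 ->
    (forall x y, K x -> K y ->
      mnorm2 (H x - H y) <= G * enorm (x - y)) ->
  exists2 C : R, 0 < C & forall x, K x -> mnorm2 (H x) <= C.
Proof.
move=> cK K0 lip.
have [D D0 hD] := compact_enorm_bounded cK (fun x _ => @cvg_id _ (nbhs x)).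
exists (`|G| * (D + enorm (- x0)) + mnorm2 (H x0) + 1) => [|x Kx].
  by rewrite ltr_wpDl// addr_ge0 ?mnorm2_ge0// mulr_ge0// addr_ge0 ?enorm_ge0//
    ltW.
rewrite -(subrK (H x0) (H x)); apply: ler_wpDr => //.
apply: le_trans (mnorm2D _ _) _; rewrite lerD2r.
apply: le_trans (lip _ _ Kx K0) _.
apply: (@le_trans _ _ (`|G| * enorm (x - x0))).
  by rewrite ler_wpM2r ?enorm_ge0// ler_norm.
by rewrite ler_wpM2l// (le_trans (enormD _ _))// lerD2r hD.
Qed.

End Compactness.

(** * Scalar recursion preserving the threshold *)

Section Scalar.
Context {R : realType}.

(** Either the decrease dominates [b * h ^+ 2] and [w <= v], or [v] lies below the balance point
    [k * s] of the two terms, and adding [b * h ^+ 2 <= b * s] still gives at most [delta]. *)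
Lemma descent_step {a b theta h v w : R} : 0 < a -> 0 < b -> 2^-1 <= theta ->
    theta < 1 -> 0 < h -> h <= 1 ->
  let delta := ((Num.sqrt (b / a)) `^ theta^-1 + b) * h `^ theta^-1 in
  0 <= v -> v <= delta -> w <= v - a * (v `^ theta) ^+ 2 + b * h ^+ 2 ->
  w <= delta.
Proof.
move=> a0 b0 th1 th2 h0 h1 delta v0 vd wle.
have th0 : 0 < theta by apply: lt_le_trans th1; rewrite invr_gt0.
have [le|lt] := leP (b * h ^+ 2) (a * (v `^ theta) ^+ 2).
  apply: le_trans wle _; lra.
pose k := (Num.sqrt (b / a)) `^ theta^-1.
pose s := h `^ theta^-1.
have s0 : 0 <= s by exact: powR_ge0.
have k0 : 0 <= k by exact: powR_ge0.
have ks : (k * s) `^ theta = Num.sqrt (b / a) * h.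
  rewrite powRM// /k /s -!powRrM mulVf ?gt_eqF// !powRr1 ?sqrtr_ge0//.
  exact: ltW.
have vle : v <= k * s.
  rewrite leNgt; apply/negP => kv.
  have : (k * s) `^ theta <= v `^ theta.
    by apply: ge0_ler_powR; rewrite ?nnegrE ?mulr_ge0//; exact: ltW.
  rewrite ks => sle.
  have : (Num.sqrt (b / a) * h) ^+ 2 <= (v `^ theta) ^+ 2.
    by rewrite lerXn2r// nnegrE ?powR_ge0// mulr_ge0 ?sqrtr_ge0// ltW.
  rewrite exprMn sqr_sqrtr; last by rewrite divr_ge0// ltW.
  rewrite mulrAC ler_pdivrMr// mulrC [leRHS]mulrC.
  by move: lt; rewrite ltNge (mulrC b) => /negP.
(* Since [theta >= 1/2], the exponent [theta^-1] is at most 2, and [h <= 1]. *)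
have hs : h ^+ 2 <= s.
  rewrite -powR_mulrn; last exact: ltW.
  apply: ger_powR; first by rewrite h0.
  by rewrite -(invrK 2) lef_pV2 ?posrE// invr_gt0.
have abs : 0 <= a * (v `^ theta) ^+ 2 by rewrite mulr_ge0 ?sqr_ge0// ltW.
have bhs : b * h ^+ 2 <= b * s by rewrite ler_wpM2l// ltW.
have -> : delta = k * s + b * s by rewrite /delta mulrDl.
lra.
Qed.

End Scalar.

(** * One feedback step, and the bookkeeping of gain updates *)

Section Steps.
Context {R : realType} {n : nat}.
Implicit Types (U P : set 'rV[R]_n) (V : 'rV[R]_n -> R).

(** Orthogonality removes the cross terms. The Hessian bound [beta^-1] lets the quadratic gradient
    term consume at most half of the linear decrease, while the bound [L] keeps the drift constant
    independent of [beta]. *)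
Lemma feedback_step_le {U V} {x u : 'rV[R]_n} {beta h F L : R} :
    open U -> Ck 1 U V -> (forall i, Ck 1 U (partial i V)) ->
    0 < beta -> 0 < L -> dotv (grad V x) u = 0 -> enorm u <= F ->
    (forall t : R, 0 <= t <= 1 ->
       let z := x + t *: (h *: u - beta *: grad V x) in
       [/\ U z, mnorm2 (hessian V z) <= beta^-1 & mnorm2 (hessian V z) <= L]) ->
  V (x + h *: u - beta *: grad V x) <=
    V x - beta / 2 * enorm (grad V x) ^+ 2 + L * F ^+ 2 / 2 * h ^+ 2.
Proof.
move=> Uo C1 C2 b0 L0 gu uF seg; pose B := Num.min beta^-1 L.
set g := grad V x in gu seg *; pose v := h *: u - beta *: g.
have := @taylor2_le _ _ U V x v B Uo C1 C2; rewrite {1}/v addrA.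
have seg' (t : R) : 0 <= t <= 1 ->
    U (x + t *: v) /\ mnorm2 (hessian V (x + t *: v)) <= B.
  by move=> /seg/= [? ? ?]; split => //; rewrite le_min; apply/andP.
move=> /(_ seg'); rewrite /v -scaleNr.
rewrite !(dotvDl, dotvDr, dotvZl, dotvZr) -/g (dotvC u g) gu !mulr0 !add0r
  addr0.
move=> /le_trans; apply.
rewrite sqr_enorm.
have uu : dotv u u <= F ^+ 2.
  by rewrite -sqr_enorm lerXn2r ?nnegrE ?enorm_ge0//
    (le_trans (enorm_ge0 _) uF).
have h1 : B * (h * (h * dotv u u)) <= L * (h * (h * F ^+ 2)).
  have e (a z : R) : a * (h * (h * z)) = h ^+ 2 * (a * z) by ring.
  rewrite !e ler_wpM2l ?sqr_ge0//; apply: (@le_trans _ _ (L * dotv u u)).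
    by rewrite ler_wpM2r ?dotv_ge0// /B ge_min lexx orbT.
  by rewrite ler_wpM2l// ltW.
have h2 : B * (beta * (beta * dotv g g)) <= beta * dotv g g.
  rewrite (mulrA B) ler_piMl//; first by rewrite mulr_ge0 ?dotv_ge0// ltW.
  by rewrite -ler_pdivlMr// mul1r /B ge_min lexx.
lra.
Qed.

(* The refresh index [q] satisfies [tnext <= q h + T], so as long as no refresh
   occurs the elapsed time [(k - q) h] stays below [T]. *)
Lemma integrator_invariant {f : 'rV[R]_n -> 'rV[R]_n} {V P}
    {h c Hmin T D : R} {xI} : 0 < h -> 0 < T -> 0 <= D -> P xI ->
    (forall y x, P y -> P x -> enorm (x - y) <= T * D ->
       let x' := x + h *: f x -
         (c * Num.max (mnorm2 (hessian V y)) Hmin)^-1 *: grad V x in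
       P x' /\ enorm (x' - x) <= h * D) ->
  forall k, P (integrator f V h c Hmin T xI k).
Proof.
move=> h0 T0 D0 PI step.
pose age (k q : nat) : R := (k%:R - q%:R) * h.
pose gains y := (c * Num.max (mnorm2 (hessian V y)) Hmin)^-1.
(* Here [y] is the position at the last refresh and [q] its step index. [tnext] is only bounded
   above, since a refresh increments its old value rather than the current time. *)
pose J k (s : state) := exists y q, [/\ P y, gain s = gains y,
  tnext s <= q%:R * h + T & enorm (pos s - y) <= age k q * D].
have upd k (s : state) : P (pos s) -> (k = 0%N /\ tnext s = 0) \/ J k s ->
  let s' := update_gain V h c Hmin T k s in
  pos s' = pos s /\ exists y q, [/\ P y, gain s' = gains y,
    tnext s' <= q%:R * h + T, enorm (pos s' - y) <= age k q * D & age k q <= T].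
  move=> Ps Js; rewrite /update_gain; case: ifPn => [le|].
    split => //; exists (pos s), k; rewrite /age /= !subrr !mul0r enorm0.
    by split => //; [rewrite lerD2r|exact: ltW].
  rewrite -ltNge => lt; split => //; case: Js => [[k0 t0]|].
    by move: lt; rewrite k0 t0 mul0r ltxx.
  move=> [y [q [Py gE tq xy]]]; exists y, q; split => //.
  by rewrite /age mulrBl lerBlDl; apply: ltW; exact: lt_le_trans lt tq.
(* The initial state is kept apart: its dummy gain 0 is not of the form [gains y], but [tnext = 0]
   forces a refresh at [k = 0]. *)
suff inv k : let s := integrator_state f V h c Hmin T xI k in
    P (pos s) /\ ((k = 0%N /\ tnext s = 0) \/ J k s).
  by move=> k; have [] := inv k.
elim: k => [|k [Ps Js]]; first by split => //; left.
rewrite /=; have [] := upd k _ Ps Js; set s' := update_gain _ _ _ _ _ _ _.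
move=> pE [y [q [Py gE tq xy ageT]]]; rewrite -pE in Ps.
have [|P' d'] := step y (pos s') Py Ps.
  by apply: le_trans xy _; rewrite ler_wpM2r.
rewrite /advance /= gE; split => //; right; exists y, q; split => //=.
set x' := _ - _ *: _ in P' d' *.
have -> : x' - y = (x' - pos s') + (pos s' - y) by rewrite subrKA.
apply: le_trans (enormD _ _) _.
have -> : age k.+1 q * D = h * D + age k q * D by rewrite /age -natr1; ring.
exact: lerD.
Qed.

End Steps.

(** * Choice of the constants and proof of the invariant *)

Theorem theorem5 (R : realType) (n d l : nat)
    (S U : set 'rV[R]_n)
    (f : 'rV[R]_n -> 'rV[R]_n)
    (F : 'I_l -> 'rV[R]_n -> R)
    (xI : 'rV[R]_n)
    (V : 'rV[R]_n -> R)
    (nu Gamma eps mu theta CM : R)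
    (M : R -> R)
    (S_manifold : embedded_submanifold d S)
    (U_open : open U) (S_sub_U : S `<=` U)
    (f_smooth : smooth_on U f)
    (F_smooth : forall j, smooth_on U (F j))
    (f_dynamics : global_dynamics S f)
    (F_first_integral : forall j, first_integral S f (F j))
    (xI_in_S : S xI)
    (V_analytic : analytic_on U V)
    (V_ge0 : forall x, U x -> 0 <= V x)
    (V_zero : U `&` V @^-1` [set 0] = integral_level S F xI)
    (A1 : forall x, U x -> dotv (grad V x) (f x) = 0)
    (nu_gt0 : 0 < nu)
    (A2 : compact (sublevel U V nu))
    (A3 : forall x, sublevel U V nu x -> grad V x = 0 -> V x = 0)
    (hessian_lipschitz : forall x y, sublevel U V nu x -> sublevel U V nu y ->
       mnorm2 (hessian V x - hessian V y) <= Gamma * enorm (x - y))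
    (eps_gt0 : 0 < eps) (eps_lt_nu : eps < nu)
    (mu_gt0 : 0 < mu) (theta_ge : 2^-1 <= theta) (theta_lt1 : theta < 1)
    (lojasiewicz : forall x, sublevel U V eps x ->
       mu * (V x) `^ theta <= enorm (grad V x))
    (M_class_K : class_K nu M)
    (M_bound : forall v : R, 0 <= v <= nu ->
       (ereal_sup [set (enorm (grad V x))%:E |
                    x in [set x | sublevel U V nu x /\ (V x <= v)%R]]
        <= (M v)%:E)%E)
    (CM_gt0 : 0 < CM)
    (M_growth : forall delta : R, 0 <= delta <= nu ->
       M delta <= CM * delta `^ theta) :
  forall c Hmin : R, 1 < c -> 0 < Hmin ->
  exists Tupdate h0 : R, [/\ 0 < Tupdate, 0 < h0 &
    forall h : R, 0 < h -> h < h0 -> forall k : nat,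
      U (integrator f V h c Hmin Tupdate xI k) /\
      V (integrator f V h c Hmin Tupdate xI k) <= eps].
Proof.
move=> c Hmin c1 Hmin0.
have [smV _] := V_analytic.
have C1V : Ck 1 U V := smV 1%N.
have C2V i : Ck 1 U (partial i V) by have [_ /(_ i)[]] := smV 2%N.
have cV x : U x -> {for x, continuous V} by have [+ _] := smV 0%N; apply.
have cf x : U x -> {for x, continuous f} by have [+ _] := f_smooth 0%N; apply.
pose K := sublevel U V nu.
have [UxI VxI] : U xI /\ V xI = 0.
  by have : integral_level S F xI xI by []; rewrite -V_zero.
have levelP x e : U x -> V x <= e -> sublevel U V e x.
  by move=> Ux Vx; split => //=; rewrite in_itv/= V_ge0.
have KxI : K xI by apply: levelP => //; rewrite VxI ltW.
have [r r0 thick] := sublevel_thickening U_open cV V_ge0 A2 eps_lt_nu.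
have [Fb Fb0 fF] : exists2 C : R, 0 < C & forall x, K x -> enorm (f x) <= C.
  by apply: compact_enorm_bounded => // x [Ux _]; exact: cf.
have [L L0 HL] := lipschitz_mnorm2_bounded A2 KxI hessian_lipschitz.
have theta0 : 0 < theta by apply: lt_le_trans theta_ge; rewrite invr_gt0.
have c0 : 0 < c by exact: lt_trans c1.
(* [bmin] and [bmax] enclose every gain computed at a point of [K]. *)
pose bmin := (c * Num.max L Hmin)^-1.
pose bmax := (c * Hmin)^-1.
have bmin0 : 0 < bmin by rewrite invr_gt0 mulr_gt0// lt_max L0.
have bmax0 : 0 < bmax by rewrite invr_gt0 mulr_gt0.
(* [a] and [b] are the coefficients of decrease and drift in one step; [kap] is then the constant
   that [descent_step] requires. *)
pose a := bmin * mu ^+ 2 / 2.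
pose b := L * Fb ^+ 2 / 2.
have a0 : 0 < a by rewrite divr_gt0// mulr_gt0// exprn_gt0.
have b0 : 0 < b by rewrite divr_gt0// mulr_gt0// exprn_gt0.
pose kap := (Num.sqrt (b / a)) `^ theta^-1 + b.
have kap0 : 0 < kap by rewrite ltr_wpDl// powR_ge0.
(* On the invariant set the gradient is at most [G * h], so [h * D] bounds the length of a step. *)
pose G := CM * kap `^ theta.
have G0 : 0 < G by rewrite mulr_gt0// powR_gt0.
pose D := Fb + bmax * G.
have D0 : 0 < D by rewrite addr_gt0// mulr_gt0.
pose Gam := `|Gamma| + 1.
have Gam0 : 0 < Gam by rewrite ltr_wpDl.
(* A displacement of [rho] changes the Hessian norm by at most [(c - 1) * Hmin]. Half of it is
   reserved for the drift since the last refresh, half for the current step; hence the 2 in [T]. *)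
pose rho := (c - 1) * Hmin / Gam.
have rho0 : 0 < rho by rewrite divr_gt0// mulr_gt0// subr_gt0.
pose T := rho / (2 * D).
have T0 : 0 < T by rewrite divr_gt0// mulr_gt0.
(* In order: [h <= 1] for the comparison of powers, [h <= T] for the drift budget, [h * D <= r] to
   keep the step inside [K], and [delta <= eps]. *)
pose h0 := Num.min (Num.min 1 T) (Num.min (r / D) ((eps / kap) `^ theta)).
exists T, h0; split => //.
  by rewrite !lt_min ltr01 T0 divr_gt0//= powR_gt0// divr_gt0.
move=> h hgt0; rewrite !lt_min -andbA => /and4P[h1 hT hr heps].
pose delta := kap * h `^ theta^-1.
have delta0 : 0 <= delta by rewrite mulr_ge0 ?powR_ge0// ltW.
have delta_eps : delta <= eps.
  rewrite /delta mulrC -ler_pdivlMr//.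
  have -> : eps / kap = ((eps / kap) `^ theta) `^ theta^-1.
    by rewrite -powRrM mulfV ?gt_eqF// powRr1// divr_ge0// ltW.
  by apply: ge0_ler_powR; rewrite ?nnegrE ?invr_ge0 ?powR_ge0 1?ltW.
(* The growth exponent of [M] cancels [theta^-1] in [delta], which makes the gradient bound linear
   in [h]. *)
have delta_theta : CM * delta `^ theta = G * h.
  rewrite /delta powRM ?powR_ge0//; last exact: ltW.
  by rewrite -powRrM mulVf ?gt_eqF// powRr1 ?mulrA// ltW.
pose P := [set x | U x /\ V x <= delta].
have PK e x : delta <= e -> P x -> sublevel U V e x.
  by move=> de [Ux Vx]; apply: levelP => //; exact: le_trans Vx de.
have delta_nu : delta <= nu by exact: le_trans delta_eps (ltW _).
have gradP x : P x -> enorm (grad V x) <= G * h.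
  move=> [Ux Vx]; rewrite -delta_theta.
  have Vnu : 0 <= V x <= nu by rewrite V_ge0// (le_trans Vx).
  apply: (@le_trans _ _ (M (V x))).
    rewrite -lee_fin; apply: le_trans (M_bound _ Vnu); apply: ereal_sup_ubound.
    by exists x => //; split => //; apply: levelP => //; case/andP: Vnu.
  apply: le_trans (M_growth _ Vnu) _; rewrite ler_wpM2l ?(ltW CM_gt0)//.
  by apply: ge0_ler_powR; rewrite ?nnegrE ?V_ge0// ltW.
suff inv k : P (integrator f V h c Hmin T xI k).
  by move=> k; have [? Vk] := inv k; split => //; exact: le_trans Vk delta_eps.
apply: (integrator_invariant (D := D)) => //; first exact: ltW.
  by split => //; rewrite VxI.
move=> y x Py Px xy x'; set B := Num.max (mnorm2 (hessian V y)) Hmin in x' *.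
have B0 : 0 < B by rewrite lt_max Hmin0 orbT.
pose beta := (c * B)^-1.
have beta0 : 0 < beta by rewrite invr_gt0 mulr_gt0.
have beta_min : bmin <= beta.
  rewrite lef_pV2 ?posrE ?mulr_gt0// ?lt_max ?L0// ler_pM2l//.
  by rewrite ge_max !le_max lexx orbT andbT HL//; exact: PK.
have beta_max : beta <= bmax.
  by rewrite lef_pV2 ?posrE ?mulr_gt0// ler_pM2l// le_max lexx orbT.
pose v := h *: f x - beta *: grad V x.
have x'E : x' = x + v by rewrite /x' /v addrA.
have Kx : K x by exact: PK.
have vle : enorm v <= h * D.
  rewrite /v -scaleNr; apply: le_trans (enormD _ _) _; rewrite !enormZ normrN.
  rewrite !ger0_norm ?(ltW hgt0) ?(ltW beta0)// mulrDr; apply: lerD.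
    by rewrite ler_wpM2l ?fF// ltW.
  rewrite mulrC [leRHS]mulrC -mulrA [leRHS]mulrC.
  by apply: ler_pM; rewrite ?enorm_ge0 ?gradP// ltW.
have x'x : x' - x = v by rewrite x'E addrAC subrr add0r.
rewrite x'x; split => //.
have seg (t : R) : 0 <= t <= 1 -> let z := x + t *: v in
    [/\ U z, mnorm2 (hessian V z) <= beta^-1 & mnorm2 (hessian V z) <= L].
  move=> /andP[t0 t1] z.
  have tv : enorm (t *: v) <= h * D.
    by rewrite enormZ ger0_norm// (le_trans _ vle)// ler_piMl ?enorm_ge0.
  have Kz : K z.
    apply: (thick x); first exact: PK.
    rewrite /z addrAC subrr add0r (le_trans tv)//.
    by rewrite -ler_pdivlMr// ltW.
  split; [by case: Kz| |exact: HL].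
  rewrite invrK -(subrK (hessian V y) (hessian V z)).
  apply: le_trans (mnorm2D _ _) _.
  have Ky : K y by exact: PK.
  have dzy : enorm (z - y) <= rho.
    rewrite /z addrAC; apply: le_trans (enormD _ _) _.
    apply: (@le_trans _ _ (T * D + T * D)).
      by apply: lerD => //; apply: le_trans tv _; rewrite ler_wpM2r// ltW.
    by rewrite le_eqVlt /T; apply/orP; left; apply/eqP; field; rewrite gt_eqF.
  (* [U^nu] need not be convex: the Lipschitz bound is used between [z] and the
     refresh point [y] directly. *)
  have drift : mnorm2 (hessian V z - hessian V y) <= (c - 1) * Hmin.
    apply: le_trans (hessian_lipschitz _ _ Kz Ky) _.
    apply: (@le_trans _ _ (Gam * enorm (z - y))).
      by rewrite ler_wpM2r ?enorm_ge0// /Gam ler_wpDr// ler_norm.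
    by rewrite mulrC -ler_pdivlMr.
  have HB : mnorm2 (hessian V y) <= B by rewrite le_max lexx.
  have HminB : Hmin <= B by rewrite le_max lexx orbT.
  (* The Hessian norm at [z] is at most [B + (c - 1) * B = c * B], which is the inverse of
     [beta]. *)
  have : (c - 1) * Hmin <= (c - 1) * B by rewrite ler_wpM2l// subr_ge0 ltW.
  lra.
have Ux' : U x' by have [] := seg 1 _; rewrite ?ler01 ?lexx// scale1r -x'E.
split => //.
apply: (descent_step (theta := theta) a0 b0 theta_ge theta_lt1 hgt0 (ltW h1) (v
  := V x)).
- by apply: V_ge0; case: Px.
- by case: Px.
have A1x : dotv (grad V x) (f x) = 0 by apply: A1; case: Px.
apply: le_trans (feedback_step_le U_open C1V C2V beta0 L0 A1x (fF x Kx) seg) _.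
rewrite lerD2r lerD2l lerN2.
have loj := lojasiewicz _ (PK _ _ delta_eps Px).
have loj2 : mu ^+ 2 * (V x `^ theta) ^+ 2 <= enorm (grad V x) ^+ 2.
  by rewrite -exprMn lerXn2r// nnegrE ?enorm_ge0// mulr_ge0 ?powR_ge0// ltW.
(* Factored this way, the comparison splits into [bmin <= beta] and the squared Lojasiewicz
   inequality. *)
have -> : a * (V x `^ theta) ^+ 2 = bmin / 2 * (mu ^+ 2 * (V x `^ theta) ^+ 2).
  by rewrite /a; field.
apply: ler_pM => //.
- by rewrite divr_ge0// ltW.
- by rewrite mulr_ge0 ?sqr_ge0.
- by rewrite ler_wpM2r// invr_ge0.
Qed.
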